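(* For each fixed real $p$ with $1 \leq p < 3$, there exist infinitely many connected graphs $G$, each together with a pair of non-adjacent vertices $u, v$ of $G$, such that \[ \mathcal{E}_p^+(G + uv) < \mathcal{E}_p^+(G). \]
   Context: All graphs are finite, simple, undirected and unweighted; eigenvalues of a graph are those of its adjacency matrix. For a graph $G$ and real $p>0$, the positive $p$-energy is $\mathcal{E}_p^+(G) = \sum_{\lambda_i(G) > 0} \lambda_i(G)^p$, the sum over the positive adjacency eigenvalues counted with multiplicity. $G + uv$ denotes the graph obtained from $G$ by adding the edge $uv$. *)

(* Defs.v *)
From HB Require Import structures.
From mathcomp Require Import all_boot all_order all_algebra.
From mathcomp Require Import polyrcf.
From mathcomp Require Import all_classical all_reals exp.

Set Implicit Arguments.
Unset Strict Implicit.
Unset Printing Implicit Defensive.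

Import Order.TTheory GRing.Theory Num.Theory.

Local Open Scope ring_scope.

Record sgraph := SGraph {
  vertex :> finType;
  adj : rel vertex;
  adj_sym : symmetric adj;
  adj_irrefl : irreflexive adj }.

Definition connected_graph (G : sgraph) : Prop :=
  (0 < #|G|)%N /\ forall x y : G, connect (@adj G) x y.

Definition graph_iso (G H : sgraph) : Prop :=
  exists2 f : G -> H, bijective f & forall x y, adj (f x) (f y) = adj x y.

Section AddEdge.
Variables (G : sgraph) (u v : G).

(* The guard [x != y] makes this a simple graph even in the degenerate case
   [u = v], where it leaves G unchanged. *)
Definition add_edge_rel : rel G := fun x y =>
  adj x y || (x != y) && ((x == u) && (y == v) || (x == v) && (y == u)).

Lemma add_edge_sym : symmetric add_edge_rel.
Proof.
move=> x y; rewrite /add_edge_rel adj_sym (eq_sym x y) [in RHS]orbC.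
by rewrite [in LHS]orbC (andbC (y == u)) (andbC (y == v)) (orbC (_ && (y == v))).
Qed.

Lemma add_edge_irrefl : irreflexive add_edge_rel.
Proof. by move=> x; rewrite /add_edge_rel adj_irrefl eqxx. Qed.

Definition add_edge : sgraph := SGraph add_edge_sym add_edge_irrefl.

End AddEdge.

Section Energy.
Variable R : realType.

Definition adjacency_matrix (G : sgraph) : 'M[R]_#|G| :=
  \matrix_(i, j) (adj (enum_val i) (enum_val j))%:R.

(* [rootsR] lists each real root once, so the multiplicity is put back by
   [mup]; all eigenvalues of a graph are real, the matrix being symmetric. *)
Definition pos_energy (p : R) (G : sgraph) : R :=
  let chi := char_poly (adjacency_matrix G) in
  \sum_(x <- rootsR chi | 0 < x) (x `^ p) *+ mup x chi.

End Energy.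

(* Main.v *)
Require Import Defs.
From mathcomp Require Import all_boot all_order all_algebra.
From mathcomp Require Import all_classical all_reals exp.
From mathcomp Require Import polyrcf.
From mathcomp Require Import zify ring lra.

Import Order.TTheory GRing.Theory Num.Theory.
Local Open Scope ring_scope.

(* Let n = k (k + 1), and join two new non-adjacent vertices u and v to the two
   halves of K_{n,n}, each half having n / 2 vertices on either side.  Adding uv
   is the sum of two rank-one updates of the adjacency matrix, along e_u + e_v
   and e_u - e_v, which act on invariant planes: they replace the factors
   t (t - n) - n and t^2 - n of the characteristic polynomial by
   (t - 1) (t - n) - n and (t + 1) t - n and leave the rest alone.  The positive
   root of the first grows by at most 1/n, up to n + 1, and that of the second
   drops from sqrt (k (k + 1)) to k, by at least 1/3.  So the p-energy gains
   O(n^(p-2)) = O(k^(2p-4)) and loses at least k^(p-1) / 3, and the loss wins for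
   large k as p < 3. *)

(** * Characteristic polynomials under rank-one perturbation *)

(** Two ways of triangularising the block matrix with rows [(a, u)] and [(v, 1)] are compared. The
    extra factor [a] avoids both division and the exponent [N - 1]. *)
Lemma det_scalar_sub_rank1 (D : idomainType) (N : nat) (a : D)
    (u : 'cV[D]_N) (v : 'rV[D]_N) :
  a != 0 ->
  a * \det (a%:M - u *m v) = a ^+ N * (a - (v *m u) 0 0).
Proof.
move=> a0.
have e1 : block_mx a%:M u v (1%:M : 'M_1) *m block_mx 1%:M 0 (- v) 1%:M
  = block_mx (a%:M - u *m v) u 0 1%:M.
  rewrite mulmx_block !mulmx1 !mulmx0 !add0r mul1mx.
  by rewrite mulmxN subrr.
have e2 : block_mx a%:M u v (1%:M : 'M_1) *m block_mx 1%:M (- u) 0 a%:M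
  = block_mx a%:M 0 v (a%:M - v *m u).
  rewrite mulmx_block !mulmx1 !mulmx0 !addr0 mul1mx !mulmxN.
  by rewrite mul_scalar_mx mul_mx_scalar addNr addrC.
have := congr1 determinant e1; have := congr1 determinant e2.
rewrite !det_mulmx !det_ublock !det_lblock !det1 !mul1r !mulr1 !det_scalar.
by move=> h2 h1; rewrite -h1 mulrC -[X in _ * X = _]expr1 h2 det_mx11 !mxE eqxx.
Qed.

(* The span of [w] and [s] is [A]-invariant and carries the characteristic
   polynomial ['X * ('X - S) - n]; a rank-one perturbation along [w] only
   changes that factor. *)
Lemma char_poly_rank1 (F : fieldType) (N : nat) (A : 'M[F]_N)
    (w s : 'rV[F]_N) (n S c q : F) :
  w *m A = s -> s *m A = n *: w + S *: s ->
  (w *m w^T) 0 0 = q -> (s *m w^T) 0 0 = 0 ->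
  char_poly (A + c *: (w^T *m w)) * ('X * ('X - S%:P) - n%:P) =
  char_poly A * (('X - (c * q)%:P) * ('X - S%:P) - n%:P).
Proof.
move=> wA sA wwq sw0.
set P := 'X * ('X - S%:P) - n%:P.
have P0 : P != 0.
  have : P \is monic.
    rewrite monicE lead_coefDl.
      by rewrite lead_coefM lead_coefX lead_coefXsubC mulr1.
    rewrite size_polyN size_polyC size_mul ?polyX_eq0 ?polyXsubC_eq0 //.
    by rewrite size_polyX size_XsubC; case: (n != 0).
  by apply: contraTneq => ->; rewrite monicE lead_coef0 eq_sym oner_neq0.
pose W := map_mx polyC w; pose T := map_mx polyC s.
pose M := char_poly_mx A.
(* A division-free resolvent: [z] is [P] times [W] times the inverse of [M], so the update of [M]
   factors through [M] itself. *)
pose z := ('X - S%:P) *: W + T.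
have WM : W *m M = 'X *: W - T.
  by rewrite /M mulmxBr mul_mx_scalar -map_mxM wA.
have TM : T *m M = 'X *: T - (n%:P *: W + S%:P *: T).
  by rewrite /M mulmxBr mul_mx_scalar -map_mxM sA map_mxD !map_mxZ.
have zM : z *m M = P *: W.
  rewrite mulmxDl -scalemxAl WM TM /P scalerBr scalerA.
  by apply/matrixP=> i j; rewrite !mxE; ring.
have fact : P *: char_poly_mx (A + c *: (w^T *m w))
    = (P%:M - (c%:P *: W^T) *m z) *m M.
  rewrite mulmxBl mul_scalar_mx -mulmxA zM -scalemxAl -scalemxAr.
  rewrite /char_poly_mx map_mxD map_mxZ map_mxM map_trmx -/W.
  rewrite opprD addrA [in LHS]scalerBr; congr (_ - _).
  by rewrite !scalerA mulrC.
have := congr1 (fun X => P * determinant X) fact.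
rewrite detZ det_mulmx mulrA [RHS]mulrA det_scalar_sub_rank1 // -exprS.
rewrite exprSr -!mulrA => /(mulfI (expf_neq0 N P0)).
rewrite mulrC => ->; rewrite mulrC; congr (_ * _).
have WW : (W *m W^T) 0 0 = q%:P by rewrite /W /T map_trmx -map_mxM mxE wwq.
have TW : (T *m W^T) 0 0 = 0 by rewrite /W /T map_trmx -map_mxM mxE sw0.
rewrite -scalemxAr mxE mulmxDl mxE -scalemxAl mxE WW TW /P rmorphM /=.
by ring.
Qed.

Lemma mem_rootsR (R : rcfType) (P : {poly R}) (x : R) :
  P != 0 -> (x \in rootsR P) = root P x.
Proof.
by move=> P0; have /(_ x) := roots_on_rootsR P0; rewrite in_itv /= => <-.
Qed.

(** * Energy of a polynomial *)

Section PolyEnergy.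
Variables (R : realType) (p : R).
Implicit Types P Q : {poly R}.

Definition poly_energy P : R :=
  \sum_(x <- rootsR P | 0 < x) (x `^ p) *+ mup x P.

(** Non-roots have [mup] zero. A common list of points then lets the energies of two factors be
    added termwise. *)
Lemma poly_energy_superset P (s : seq R) :
  P != 0 -> uniq s -> {subset rootsR P <= s} ->
  poly_energy P = \sum_(x <- s | 0 < x) (x `^ p) *+ mup x P.
Proof.
move=> P0 us sub.
rewrite (bigID (root P) (fun x => 0 < x)) /= [X in _ + X]big1 ?addr0; last first.
  by move=> x /andP[_ nr]; rewrite (mupNroot nr).
under [RHS]eq_bigl do rewrite andbC.
rewrite -big_filter_cond.
apply: perm_big; apply: uniq_perm; rewrite ?filter_uniq ?uniq_roots //.
move=> x; rewrite mem_filter mem_rootsR //; case h: (root P x) => //=.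
by rewrite sub // mem_rootsR.
Qed.

Lemma poly_energyM P Q :
  P != 0 -> Q != 0 -> poly_energy (P * Q) = poly_energy P + poly_energy Q.
Proof.
move=> P0 Q0; have PQ0 : P * Q != 0 by rewrite mulf_neq0.
have us : uniq (rootsR (P * Q)) by exact: uniq_roots.
rewrite (@poly_energy_superset P (rootsR (P * Q))) //; last first.
  by move=> x; rewrite !mem_rootsR // rootM => ->.
rewrite (@poly_energy_superset Q (rootsR (P * Q))) //; last first.
  by move=> x; rewrite !mem_rootsR // rootM => ->; rewrite orbT.
rewrite -big_split /=; apply: eq_bigr => x _.
by rewrite mupM // mulrnDr.
Qed.

Lemma poly_energy_XsubC (a : R) :
  poly_energy ('X - a%:P) = if 0 < a then a `^ p else 0.
Proof.
rewrite (@poly_energy_superset _ [:: a]) ?polyXsubC_eq0 //; last first.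
  by move=> x; rewrite mem_rootsR ?polyXsubC_eq0 // root_XsubC inE.
rewrite big_cons big_nil addr0; case: ifP => // _.
by rewrite -['X - a%:P]expr1 mup_XsubCX eqxx mulr1n.
Qed.

End PolyEnergy.

(** * Estimates on the four positive roots *)

Section RealEstimates.
Variable R : realType.
Implicit Types a b p x k n : R.

Lemma powR_diff_ge p a b :
  1 <= p -> 0 < b -> b <= a -> b `^ (p - 1) * (a - b) <= a `^ p - b `^ p.
Proof.
move=> p1 b0 ba; have a0 := lt_le_trans b0 ba.
have p0 : 0 < p by exact: lt_le_trans ltr01 p1.
rewrite -(mulr_powRB1 (ltW a0) p0) -(mulr_powRB1 (ltW b0) p0).
have : b `^ (p - 1) <= a `^ (p - 1).
  by apply: ge0_ler_powR; rewrite ?subr_ge0 // nnegrE ltW.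
nra.
Qed.

(* With [r = b / a <= 1] and [p <= 3], Bernoulli reads
   [1 - r ^ p <= 1 - r ^ 3 <= 3 (1 - r)]. *)
Lemma powR_diff_le p a b :
  0 < p -> p <= 3 -> 0 < b -> b <= a ->
  a `^ p - b `^ p <= 3 * a `^ (p - 1) * (a - b).
Proof.
move=> p0 p3 b0 ba; have a0 := lt_le_trans b0 ba.
pose r := b / a.
have r0 : 0 < r by rewrite divr_gt0.
have r1 : r <= 1 by rewrite ler_pdivrMr ?mul1r.
have rE : b = a * r by rewrite mulrC divfK ?gt_eqF.
have h : r ^+ 3 <= r `^ p.
  by rewrite -powR_mulrn ?(ltW r0) //; apply: ger_powR; rewrite ?r0.
have hb : 1 - r `^ p <= 3 * (1 - r).
  have : 0 <= (1 - r) ^+ 2 * (r + 2) by rewrite mulr_ge0 ?sqr_ge0 //; lra.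
  have -> : (1 - r) ^+ 2 * (r + 2) = 3 * (1 - r) - (1 - r ^+ 3) by ring.
  lra.
rewrite rE (powRM _ (ltW a0) (ltW r0)) -(mulr_powRB1 (ltW a0) p0).
have q0 : 0 <= a `^ (p - 1) by exact: powR_ge0.
have : 0 <= a * a `^ (p - 1) * (3 * (1 - r) - (1 - r `^ p)).
  by apply: mulr_ge0; [exact: mulr_ge0 (ltW a0) q0 | rewrite subr_ge0].
lra.
Qed.

(* [x] and [z] are the positive roots of [t (t - n) - n] and [t ^ 2 - n], while
   [n + 1] and [k] are those of [(t - 1) (t - n) - n] and [(t + 1) t - n]. *)
Lemma energy_drop p k n x z :
  1 <= p -> p < 3 -> 2 <= k -> 144 < k `^ (3 - p) -> n = k * (k + 1) ->
  0 < x -> x * (x - n) = n -> 0 < z -> z * z = n ->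
  (n + 1) `^ p + k `^ p < x `^ p + z `^ p.
Proof.
move=> p1 p3 k2 kp nE x0 xE z0 zE.
have n3 : 6 <= n by nra.
(* [(k + 1/3)^2 = k^2 + 2k/3 + 1/9] is at most [k^2 + k]. *)
have kz : k + 1/3 <= z.
  rewrite leNgt; apply/negP => zk.
  have : z * z < (k + 1/3) * (k + 1/3) by rewrite ltr_pM ?ltW.
  by rewrite zE nE; nra.
have nx : n < x by rewrite -subr_gt0 -(pmulr_rgt0 _ x0) xE; lra.
set y := n + 1.
have xy : x <= y.
  rewrite leNgt; apply/negP => yx.
  have : 0 < x * (x - y) by rewrite mulr_gt0 ?subr_gt0.
  by rewrite /y; nra.
(* The equation of [x] gives [x (y - x) = x - n], and [n (x - n) <= x (x - n) = n <= x]. *)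
have dyx : n * (y - x) <= 1.
  have : x * (n * (y - x)) = n * (x - n) by rewrite /y -[in RHS]xE; nra.
  have : n * (x - n) <= x by nra.
  by nra.
have k0 : 0 < k by lra.
have Z := @powR_diff_ge p z k p1 k0 ltac:(lra).
have Y := @powR_diff_le p y x ltac:(lra) (ltW p3) x0 xy.
set K := k `^ (p - 1).
have K0 : 0 < K by exact: powR_gt0.
(* Here [y = k^2 + k + 1 <= 4 k^2], and [p - 1 <= 2] bounds the power of 4 by 16. *)
have yK : y `^ (p - 1) <= 16 * (K * K).
  have : y `^ (p - 1) <= (4 * (k * k)) `^ (p - 1).
    by apply: ge0_ler_powR; rewrite ?nnegrE ?subr_ge0 //; nra.
  have k0' := ltW k0.
  rewrite (powRM _ _ (mulr_ge0 k0' k0')) // (powRM _ k0' k0') -/K.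
  move=> /le_trans; apply; rewrite ler_wpM2r ?(mulr_ge0 (ltW K0) (ltW K0)) //.
  have -> : 16 = (4 : R) `^ 2%:R by rewrite powR_mulrn //; ring.
  by apply: ler_powR; lra.
have KK : 144 * K < k * k.
  have -> : k * k = k `^ (3 - p) * K.
    rewrite /K -powRD; last by rewrite (gt_eqF k0) implybT.
    have -> : 3 - p + (p - 1) = 2%:R by ring.
    by rewrite powR_mulrn ?ltW // expr2.
  by rewrite ltr_pM2r.
have A : 3 * y `^ (p - 1) * (y - x) <= 48 * (K * K) * (y - x).
  by rewrite ler_wpM2r ?subr_ge0 //; lra.
(* The constant 144 is [3 * 48]: since [144 K < k^2 <= n], the bound on [n (y - x)] brings the gain
   below [K / 3]. *)
have B : 48 * (K * K) * (y - x) < K / 3.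
  have h1 : 144 * K * (y - x) < 1.
    have : 144 * K * (y - x) <= k * k * (y - x).
      by rewrite ler_wpM2r ?subr_ge0 // ltW.
    nra.
  nra.
have C : K / 3 <= K * (z - k) by nra.
rewrite -/K in Z; lra.
Qed.

Lemma quadratic_pos_root (t q : R) : 0 < q ->
  exists2 a, 0 < a & a * (a - t) = q.
Proof.
move=> q0; pose d := Num.sqrt (t ^+ 2 + 4 * q).
have dE : d ^+ 2 = t ^+ 2 + 4 * q by rewrite sqr_sqrtr //; nra.
have d0 : 0 <= d by exact: sqrtr_ge0.
exists ((t + d) / 2).
  have : `|t| < d.
    rewrite -(ltr_pXn2r (n := 2)) ?nnegrE // dE -normrX ger0_norm ?sqr_ge0 //.
    lra.
  by rewrite ltr_norml; lra.
have -> : (t + d) / 2 * ((t + d) / 2 - t) = (d ^+ 2 - t ^+ 2) / 4 by field.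
by rewrite dE; field.
Qed.
End RealEstimates.

(** * The graphs and their connectedness *)

Section ApexGraph.
Variable m : nat.

(* [K_(2m,2m)] together with two apices [(false, None)] and [(true, None)]: in a
   base vertex [(b, Some (c, i))], [b] names the apex it is joined to and [c] its
   part. *)
Definition apex_vertex : finType := (bool * option (bool * 'I_m))%type.

Definition apex_adj : rel apex_vertex := fun x y =>
  match x.2, y.2 with
  | None, None => false
  | Some c, Some d => c.1 != d.1
  | _, _ => x.1 == y.1
  end.

Lemma apex_adj_sym : symmetric apex_adj.
Proof. by move=> [a [c|]] [b [d|]]; rewrite /apex_adj //= eq_sym. Qed.

Lemma apex_adj_irrefl : irreflexive apex_adj.
Proof. by move=> [a [c|]]; rewrite /apex_adj //= eqxx. Qed.

Definition apex_graph : sgraph := SGraph apex_adj_sym apex_adj_irrefl.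

Definition apex (b : bool) : apex_graph := (b, None).

Lemma card_apex_graph : #|apex_graph| = (2 * (2 * m).+1)%N.
Proof. by rewrite card_prod card_option card_prod card_bool card_ord. Qed.

Lemma connected_apex_graph : (0 < m)%N -> connected_graph apex_graph.
Proof.
move=> m0; split; first by rewrite card_apex_graph.
pose i0 := Ordinal m0; pose o : apex_graph := (true, Some (true, i0)).
have csym : connect_sym (@adj apex_graph).
  exact: sym_connect_sym (@apex_adj_sym).
have step (b c : bool) i : connect (@adj apex_graph) o (b, Some (c, i)).
  case: c; last exact: connect1.
  by apply: (@connect_trans _ _ (true, Some (false, i0))); apply: connect1.
have ox x : connect (@adj apex_graph) o x.
  case: x => b [[c i]|]; first exact: step.
  by apply: connect_trans (step b true i0) _; apply: connect1; rewrite /= /apex_adj /= eqxx.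
by move=> x y; apply: (@connect_trans _ _ o) => //; rewrite csym.
Qed.

End ApexGraph.

(** * Adjacency matrices and the effect of the new edge *)

Section Matrices.
Variable R : realType.

Definition vrow {G : sgraph} (f : G -> R) : 'rV[R]_#|G| :=
  \row_i f (enum_val i).

Lemma sum_enum_val (T : finType) (f : T -> R) :
  \sum_(i < #|T|) f (enum_val i) = \sum_x f x.
Proof. by rewrite -(big_enum_val (A := T)). Qed.

Lemma vrow_mul_adj (G : sgraph) (f : G -> R) :
  vrow f *m adjacency_matrix R G = vrow (fun y => \sum_x f x * (adj x y)%:R).
Proof.
apply/rowP => j; rewrite !mxE -(sum_enum_val _ (fun x => f x * (adj x _)%:R)).
by apply: eq_bigr => i _; rewrite !mxE.
Qed.

Lemma vrow_dot (G : sgraph) (f g : G -> R) :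
  (vrow f *m (vrow g)^T) 0 0 = \sum_x f x * g x.
Proof.
rewrite mxE -(sum_enum_val _ (fun x => f x * g x)).
by apply: eq_bigr => i _; rewrite !mxE.
Qed.

Lemma add_edge_relE (G : sgraph) (u v x y : G) : u != v -> ~~ adj u v ->
  (add_edge_rel u v x y)%:R =
  (adj x y)%:R + ((x == u)%:R * (y == v)%:R + (x == v)%:R * (y == u)%:R) :> R.
Proof.
move=> uv nuv; rewrite /add_edge_rel.
have [->|_] := eqVneq x u; last have [->|_] := eqVneq x v.
- rewrite (negPf uv) mul1r mul0r addr0 /= orbF.
  have [->|_] := eqVneq y v; first by rewrite uv (negPf nuv) add0r.
  by rewrite andbF orbF addr0.
- rewrite mul0r mul1r add0r /=.
  have [->|_] := eqVneq y u; first by rewrite eq_sym uv adj_sym (negPf nuv) add0r.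
  by rewrite andbF orbF addr0.
- by rewrite /= andbF orbF !mul0r !addr0.
Qed.

(* [e_u e_v^T + e_v e_u^T] in diagonal form. *)
Lemma adjacency_add_edge (G : sgraph) (u v : G) : u != v -> ~~ adj u v ->
  let r := vrow (fun y : G => (y == u)%:R + (y == v)%:R) in
  let t := vrow (fun y : G => (y == u)%:R - (y == v)%:R) in
  adjacency_matrix R (add_edge u v) =
  adjacency_matrix R G + 2^-1 *: (r^T *m r) + (- 2^-1) *: (t^T *m t).
Proof.
move=> uv nuv r t; apply/matrixP => i j; rewrite !mxE !big_ord1 !mxE.
by rewrite [X in X = _]add_edge_relE //; field.
Qed.

Lemma sum_option (T : finType) (f : option T -> R) :
  \sum_o f o = f None + \sum_x f (Some x).
Proof.
rewrite (bigD1 None) //=; congr (_ + _).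
rewrite (reindex_omap Some id) /=; last by case.
by apply: eq_bigl => x; rewrite eqxx.
Qed.

Lemma sum_apex_graph (m : nat) (f : apex_graph m -> R) :
  \sum_x f x = f (apex m false) + f (apex m true)
    + \sum_(b : bool) \sum_(c : bool) \sum_(i < m) f (b, Some (c, i)).
Proof.
have -> : \sum_x f x = \sum_(b : bool) \sum_o f (b, o).
  by rewrite pair_bigA; apply: eq_bigr => -[].
under eq_bigr do rewrite sum_option.
rewrite big_split /=; congr (_ + _); first by rewrite big_bool addrC.
by apply: eq_bigr => b _; rewrite pair_bigA; apply: eq_bigr => -[].
Qed.

Section ApexGraphSpectrum.
Variable m : nat.
Let n : R := (2 * m)%:R.
Let A := adjacency_matrix R (apex_graph m).

(** For [w] constant 1, and for [w] equal to 1 and -1 on the two halves, [apex_row w] and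
    [base_row w] span the invariant planes fed to [char_poly_rank1]. *)
Definition apex_row (w : bool -> R) : 'rV[R]_#|apex_graph m| :=
  vrow (fun x : apex_graph m => if x.2 is None then w x.1 else 0).
Definition base_row (w : bool -> R) : 'rV[R]_#|apex_graph m| :=
  vrow (fun x : apex_graph m => if x.2 is None then 0 else w x.1).

Lemma apex_row_adj w : apex_row w *m A = base_row w.
Proof.
rewrite vrow_mul_adj; apply/rowP => j; rewrite !mxE.
case: (enum_val j) => b [c|]; rewrite sum_apex_graph !big_bool /= -!mulr_sumr !mul0r.
- by case: b; rewrite /apex_adj /=; ring.
- by rewrite /apex_adj /=; ring.
Qed.

(** An apex sees the [n] vertices of its own half; a base vertex sees [m] base vertices of each
    half. Hence [S] is [n] for symmetric weights and 0 for antisymmetric ones. *)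
Lemma base_row_adj w :
  base_row w *m A = n *: apex_row w + (m%:R * (w false + w true)) *: base_row (fun=> 1).
Proof.
rewrite vrow_mul_adj; apply/rowP => j; rewrite !mxE.
case: (enum_val j) => b [[c i]|]; rewrite sum_apex_graph !big_bool /= -!mulr_sumr.
- by case: c; rewrite /apex_adj /= !sumr_const !card_ord; ring.
- by case: b; rewrite /apex_adj /= !sumr_const !card_ord /n natrM; ring.
Qed.

Lemma apex_row_dot w w' :
  (apex_row w *m (apex_row w')^T) 0 0 = w false * w' false + w true * w' true.
Proof.
rewrite vrow_dot sum_apex_graph big1 /= ?addr0 //.
by move=> *; rewrite big1 // => *; rewrite big1 // => *; rewrite mul0r.
Qed.

Lemma base_row_dot_apex w w' : (base_row w *m (apex_row w')^T) 0 0 = 0.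
Proof.
rewrite vrow_dot sum_apex_graph /= !mul0r !add0r.
by rewrite big1 // => *; rewrite big1 // => *; rewrite big1 // => *; rewrite mulr0.
Qed.

Lemma char_poly_apex_graph :
  char_poly (adjacency_matrix R (add_edge (apex m false) (apex m true)))
    * (('X * ('X - n%:P) - n%:P) * ('X * ('X - 0%:P) - n%:P)) =
  char_poly A
    * ((('X - 1%:P) * ('X - n%:P) - n%:P) * (('X - (- 1)%:P) * ('X - 0%:P) - n%:P)).
Proof.
rewrite adjacency_add_edge //= -/A.
set r := vrow _; set t := vrow _.
have rE : r = apex_row (fun=> 1).
  apply/rowP => j; rewrite !mxE.
  by case: (enum_val j) => -[] [c|]; rewrite !xpair_eqE /=; ring.
have tE : t = apex_row (fun b => if b then - 1 else 1).
  apply/rowP => j; rewrite !mxE.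
  by case: (enum_val j) => -[] [c|]; rewrite !xpair_eqE /=; ring.
rewrite {}rE {}tE {r t}; set r := apex_row (fun=> 1); set t := apex_row (fun b => _).
set A1 := A + 2^-1 *: _.
(* The first update kills rows orthogonal to [r], so the antisymmetric plane is still invariant
   under [A1], with the same action. *)
have orth (f : 'rV_#|apex_graph m|) : (f *m r^T) 0 0 = 0 -> f *m A1 = f *m A.
  move=> f0; rewrite /A1 mulmxDr -scalemxAr mulmxA [f *m r^T]mx11_scalar f0.
  by rewrite raddf0 mul0mx scaler0 addr0.
(* The coefficient 1/2 comes from the diagonal form, and 2 is the squared norm of [r]. *)
have e1 : char_poly A1 * ('X * ('X - n%:P) - n%:P)
  = char_poly A * (('X - (2^-1 * 2)%:P) * ('X - n%:P) - n%:P).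
  apply: (@char_poly_rank1 _ _ _ r (base_row (fun=> 1))).
  - exact: apex_row_adj.
  - by rewrite base_row_adj /n natrM; congr (_ + _ *: _); ring.
  - by rewrite apex_row_dot; ring.
  - exact: base_row_dot_apex.
have e2 : char_poly (A1 + - 2^-1 *: (t^T *m t)) * ('X * ('X - 0%:P) - n%:P)
  = char_poly A1 * (('X - (- 2^-1 * 2)%:P) * ('X - 0%:P) - n%:P).
  apply: (@char_poly_rank1 _ _ _ t (base_row (fun b => if b then - 1 else 1))).
  - by rewrite orth ?apex_row_adj // apex_row_dot; ring.
  - by rewrite orth ?base_row_dot_apex // base_row_adj subrr mulr0 !scale0r.
  - by rewrite apex_row_dot; ring.
  - exact: base_row_dot_apex.
rewrite mulVf ?pnatr_eq0 // in e1; rewrite mulNr mulVf ?pnatr_eq0 // in e2.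
by rewrite mulrCA e2 mulrCA mulrA e1 -mulrA.
Qed.

End ApexGraphSpectrum.
End Matrices.

(** * Comparison of energies and the infinite family *)

Lemma quadratic_factor (F : comNzRingType) (a b c d n : F) :
  c + d = a + b -> c * d - n = a * b ->
  ('X - c%:P) * ('X - d%:P) - n%:P = ('X - a%:P) * ('X - b%:P) :> {poly F}.
Proof.
move=> h1 h2; have -> : d = a + b - c by rewrite -h1; ring.
have -> : n = c * (a + b - c) - a * b by rewrite -h2 -h1; ring.
by rewrite !rmorphB !rmorphM /= !rmorphB !rmorphD /=; ring.
Qed.

(** Each of the four quadratic factors has exactly one positive root; the others, [n - x], [- z],
    [0] and [- (k + 1)], contribute nothing. *)
Lemma poly_energy_add_edge (R : realType) (p k x z : R) (m : nat) :
  let n := (2 * m)%:R in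
  0 < k -> n = k * (k + 1) -> 0 < x -> x * (x - n) = n -> 0 < z -> z * z = n ->
  pos_energy p (add_edge (apex m false) (apex m true)) + (x `^ p + z `^ p) =
  pos_energy p (apex_graph m) + ((n + 1) `^ p + k `^ p).
Proof.
move=> n k0 nE x0 xE z0 zE.
have n0 : 0 < n by rewrite nE; nra.
have chi0 N (B : 'M[R]_N) : char_poly B != 0 by exact: monic_neq0 (char_poly_monic B).
have nx : n - x <= 0.
  by rewrite subr_le0 ltW // -subr_gt0 -(pmulr_rgt0 _ x0) xE.
have f1 : 'X * ('X - n%:P) - n%:P = ('X - x%:P) * ('X - (n - x)%:P).
  rewrite -[X in X * _]subr0 -polyC0; apply: quadratic_factor; first by ring.
  by rewrite -[X in _ - X]xE; ring.
have f2 : 'X * ('X - 0%:P) - n%:P = ('X - z%:P) * ('X - (- z)%:P).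
  rewrite -[X in X * _]subr0 -polyC0; apply: quadratic_factor; first by ring.
  by rewrite -zE; ring.
have f3 : ('X - 1%:P) * ('X - n%:P) - n%:P = ('X - (n + 1)%:P) * ('X - 0%:P).
  by apply: quadratic_factor; ring.
have f4 : ('X - (- 1)%:P) * ('X - 0%:P) - n%:P = ('X - k%:P) * ('X - (- (k + 1))%:P).
  by apply: quadratic_factor; rewrite ?nE; ring.
have := congr1 (poly_energy R p) (char_poly_apex_graph R m).
rewrite -/n f1 f2 f3 f4 !poly_energyM ?mulf_neq0 ?polyXsubC_eq0 //.
have n1 : 0 < n + 1 by lra.
have k1 : 0 <= k + 1 by lra.
rewrite !poly_energy_XsubC k0 x0 z0 n1 ltxx ltNge nx !oppr_gt0 !ltNge k1.
by rewrite (ltW z0) /= !addr0.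
Qed.

Theorem theorem3p7 (R : realType) (p : R) (hp1 : 1 <= p) (hp3 : p < 3) :
  exists G : nat -> sgraph,
    (forall i j : nat, i <> j -> ~ graph_iso (G i) (G j)) /\
    (forall i : nat,
       connected_graph (G i) /\
       exists u v : G i,
         u <> v /\ ~~ adj u v /\
         pos_energy p (add_edge u v) < pos_energy p (G i)).
Proof.
have [N hN] : exists N : nat, forall k : nat, (N <= k)%N ->
    144 < (k%:R : R) `^ (3 - p).
  have p3 : 0 < 3 - p by rewrite subr_gt0.
  pose c := (144 : R) `^ (3 - p)^-1.
  exists (Num.truncn c).+1 => k Nk.
  have ck : c < k%:R.
    by apply: lt_le_trans (truncnS_gt c) _; rewrite ler_nat.
  have -> : 144 = c `^ (3 - p) by rewrite -powRrM mulVf ?gt_eqF // powRr1.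
  by apply: gt0_ltr_powR; rewrite ?nnegrE ?powR_ge0.
(* The shift by 2 ensures [2 <= k], and [k (k + 1)] is even, so halving it is exact. *)
pose k i := (N + i).+2; pose m i := ((k i * (k i).+1)./2)%N.
have mE i : (2 * m i = k i * (k i).+1)%N.
  by rewrite /m mul2n halfK oddM /= andbN subn0.
exists (fun i => apex_graph (m i)); split.
  (* The order [2 (k (k + 1) + 1)] determines [k], hence the index. *)
  move=> i j ij [f fbij _]; apply: ij.
  have := bij_eq_card fbij; rewrite !card_apex_graph !mE /k; nia.
move=> i; split; first by apply: connected_apex_graph; have := mE i; rewrite /k; lia.
exists (apex _ false), (apex _ true); split; [by [] | split; first by []].
have kE : (2 * m i)%:R = (k i)%:R * ((k i)%:R + 1) :> R.
  by rewrite mE natrM -natr1.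
have k2 : 2 <= (k i)%:R :> R by rewrite ler_nat.
have n0 : 0 < (2 * m i)%:R :> R by rewrite kE; nra.
have [x x0 xE] := @quadratic_pos_root R (2 * m i)%:R _ n0.
have [z z0 zE] := @quadratic_pos_root R 0 _ n0; rewrite subr0 in zE.
have k0 : 0 < (k i)%:R :> R by lra.
have := @poly_energy_add_edge R p _ x z (m i) k0 kE x0 xE z0 zE.
have kp : 144 < (k i)%:R `^ (3 - p) by apply: hN; rewrite /k; lia.
have := @energy_drop R p _ _ x z hp1 hp3 k2 kp kE x0 xE z0 zE.
lra.
Qed.
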